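(* Let $N$ be a finite set and let $A,B,C\subseteq N$ be pairwise disjoint with $A,B$ non-empty. Then $\mathcal{E}_{\langle A,B\,|\,C\rangle}$ is the set of extreme rays of the face $F_{\langle A,B\,|\,C\rangle}$ of the imset cone $\mathcal{K}^*(N)$, and $$\dim F_{\langle A,B\,|\,C\rangle}=(2^{|A|}-1)(2^{|B|}-1).$$
   Context: Unions of sets are written by juxtaposition ($AB=A\cup B$) and singletons $\{i\}$ as $i$. Functions on the power set $\mathcal{P}(N)$ are identified with vectors in $\mathbb{R}^{2^{|N|}}$; $\delta_A(S)=1$ if $S=A$ and $0$ otherwise. For pairwise disjoint $A,B,C\subseteq N$ with $A,B$ non-empty, the semi-elementary imset is $u_{\langle A,B|C\rangle}=\delta_{ABC}+\delta_C-\delta_{AC}-\delta_{BC}$; it is called elementary if $A=a$ and $B=b$ are singletons. The imset cone $\mathcal{K}^*(N)$ is the (pointed, polyhedral) convex cone of all non-negative real combinations of semi-elementary imsets (equivalently, of elementary imsets). $F_{\langle A,B|C\rangle}$ denotes the unique face of $\mathcal{K}^*(N)$ containing $u_{\langle A,B|C\rangle}$ in its relative interior. $\mathcal{E}_{\langle A,B|C\rangle}=\{u_{\langle a,b|\Gamma\rangle}\mid a\in A,\ b\in B,\ C\subseteq\Gamma\subseteq ABC\}$ (with $a,b\notin\Gamma$). A vector $u$ is called an extreme ray when the half line $\{cu\mid c\ge0\}$ is an extreme ray; so the first assertion means that the extreme rays of $F_{\langle A,B|C\rangle}$ are exactly the half lines generated by the elements of $\mathcal{E}_{\langle A,B|C\rangle}$.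 The dimension of a cone is the dimension of its linear span. *)

(* Defs.v *)
From mathcomp Require Import all_boot all_order all_algebra.
From mathcomp Require Import boolp classical_sets reals interval_inference convex.
From mathcomp Require Import ring.

Set Implicit Arguments.
Unset Strict Implicit.
Unset Printing Implicit Defensive.

Import Order.TTheory GRing.Theory Num.Theory.

Local Open Scope ring_scope.
Local Open Scope classical_set_scope.

Section ConvexGeometry.
Variables (R : realType) (T : finType).

(* R^T; the regular algebra R^o is what gives this type its vectType structure. *)
Local Notation V := {ffun T -> R^o}.

Definition conic_hull (G : set V) : set V :=
  [set x | exists (n : nat) (c : 'I_n -> R) (g : 'I_n -> V),
     (forall i, 0 <= c i /\ G (g i)) /\ x = \sum_i c i *: g i].

Definition affine_hull (F : set V) : set V :=
  [set x | exists (n : nat) (c : 'I_n -> R) (p : 'I_n -> V),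
     [/\ forall i, F (p i), \sum_i c i = 1 & x = \sum_i c i *: p i]].

(* The interior of F in affine_hull F, with open balls for the sup norm. *)
Definition relint (F : set V) : set V :=
  [set x | F x /\ exists2 e : R, 0 < e &
     forall y, affine_hull F y -> (forall t, `|y t - x t| < e) -> F y].

Definition is_face (K F : set V) : Prop :=
  [/\ convex_set (F : set (convex_lmodType V)), F `<=` K &
      forall (x y : V) (t : R), K x -> K y -> 0 < t < 1 ->
        F (t *: x + (1 - t) *: y) -> F x /\ F y].

Definition half_line (u : V) : set V := [set c *: u | c in [set c : R | 0 <= c]].

(* For cones K: an extreme ray is a face which is a (non-degenerate) half line
   from the origin. *)
Definition extreme_ray (K r : set V) : Prop :=
  is_face K r /\ exists2 u, u != 0 & r = half_line u.

Definition is_span (K : set V) (U : {vspace V}) : Prop :=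
  K `<=` [set` U] /\ forall W : {vspace V}, K `<=` [set` W] -> (U <= W)%VS.

Definition linear_span (K : set V) : {vspace V} := xget 0%VS (is_span K).

Definition cone_dim (K : set V) : nat := \dim (linear_span K).

Lemma linear_spanP (K : set V) : is_span K (linear_span K).
Proof.
apply: xgetPex.
pose P (n : nat) := `[< exists2 U : {vspace V}, K `<=` [set` U] & \dim U = n >].
have exP : exists n, P n.
  by exists (\dim {:V}); apply/asboolP; exists fullv => // x _ /=; rewrite memvf.
case: (ex_minnP exP) => n /asboolP[U KU dU] minn; exists U; split=> // W KW.
have KUW : K `<=` [set` (U :&: W)%VS].
  by move=> x Kx; rewrite /= memv_cap; apply/andP; split; [exact: KU|exact: KW].
have le_n : (n <= \dim (U :&: W))%N by apply: minn; apply/asboolP; exists (U :&: W)%VS.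
have /eqP <- : (U :&: W)%VS == U by rewrite eqEdim capvSl dU.
exact: capvSr.
Qed.

Lemma face_unique (K F G : set V) (u : V) :
  is_face K F -> relint F u -> is_face K G -> relint G u -> F = G.
Proof.
suff sub F' G' : is_face K F' -> relint F' u -> is_face K G' -> relint G' u ->
    F' `<=` G'.
  by move=> fF uF fG uG; apply/seteqP; split; apply: sub.
move=> {F G} [_ FK _] [Fu [e e0 He]] [_ _ ext] [Gu _] x Fx.
pose M := 1 + \sum_t `|u t - x t|.
have M0 : 0 < M by rewrite ltr_wpDr// sumr_ge0.
pose d := e / M.
have d0 : 0 < d by rewrite divr_gt0.
have Fz : F' ((1 + d) *: u - d *: x).
  apply: He => [|t].
    exists 2%N, (fun i => if i == 0 then 1 + d else - d),
      (fun i => if i == 0 then u else x); split=> [i||].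
    - by case: ifP.
    - rewrite !big_ord_recl big_ord0 /=; ring.
    - by rewrite !big_ord_recl big_ord0 /= addr0 scaleNr.
  have -> : ((1 + d) *: u - d *: x) t - u t = d * (u t - x t).
    by rewrite !ffunE /GRing.scale /=; ring.
  rewrite normrM gtr0_norm// /d mulrAC ltr_pdivrMr// ltr_pM2l//.
  rewrite /M (bigD1 t)//= ltr_pwDl// lerDl sumr_ge0//.
have d1 : 0 < 1 + d by rewrite addr_gt0.
have := ext _ _ (1 + d)^-1 (FK _ Fz) (FK _ Fx).
rewrite invr_gt0 d1 invf_lt1// ltrDl d0 => /(_ isT).
have -> : (1 + d)^-1 *: ((1 + d) *: u - d *: x) + (1 - (1 + d)^-1) *: x = u.
  apply/ffunP => t; rewrite !ffunE /GRing.scale /=; field.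
  exact: lt0r_neq0.
by case.
Qed.

Section ConicHull.
Variable G : set V.
Local Notation K := (conic_hull G).

Lemma conic_hull0 : K 0.
Proof.
exists 0%N, (fun=> 0), (fun=> 0); split; first by case.
by rewrite big_ord0.
Qed.

Lemma conic_hullD x y : K x -> K y -> K (x + y).
Proof.
move=> [n [c [g [cg ->]]]] [m [d [h [dh ->]]]].
exists (n + m)%N, (fun i => match split i with inl j => c j | inr k => d k end),
  (fun i => match split i with inl j => g j | inr k => h k end); split.
  by move=> i; case: (split i).
rewrite big_split_ord /=; congr (_ + _); apply: eq_bigr => i _.
  by rewrite -[lshift _ _]/(unsplit (inl i)) unsplitK.
by rewrite -[rshift _ _]/(unsplit (inr i)) unsplitK.
Qed.

Lemma conic_hullZ a x : 0 <= a -> K x -> K (a *: x).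
Proof.
move=> a0 [n [c [g [cg ->]]]]; exists n, (fun i => a * c i), g; split.
  by move=> i; case: (cg i) => c0 Gg; split=> //; rewrite mulr_ge0.
by rewrite scaler_sumr; apply: eq_bigr => i _; rewrite scalerA.
Qed.

Lemma conic_hull_gen x : G x -> K x.
Proof.
move=> Gx; exists 1%N, (fun=> 1), (fun=> x); split=> //.
by rewrite big_ord_recl big_ord0 addr0 scale1r.
Qed.

Lemma conic_hull_sum (I : Type) (r : seq I) (P : pred I) (f : I -> V) :
  (forall i, P i -> K (f i)) -> K (\sum_(i <- r | P i) f i).
Proof. by move=> Kf; apply: big_ind => //; [exact: conic_hull0|exact: conic_hullD]. Qed.

Lemma face_exists (s : seq V) (u : V) :
  (forall x, G x -> x \in s) -> K u -> exists F, is_face K F /\ relint F u.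
Proof.
move=> Gs Ku.
pose F : set V := [set x | K x /\ exists2 t : R, 0 < t & K (u - t *: x)].
have FK : F `<=` K by move=> x [].
have ext x y t : K x -> K y -> 0 < t -> 0 <= 1 - t ->
    F (t *: x + (1 - t) *: y) -> F x.
  move=> Kx Ky t0 t1 [_ [a a0 Ka]]; split=> //; exists (a * t); first by rewrite mulr_gt0.
  have -> : u - (a * t) *: x = u - a *: (t *: x + (1 - t) *: y) + (a * (1 - t)) *: y.
    by rewrite scalerDr !scalerA opprD addrA subrK.
  by apply: conic_hullD => //; apply: conic_hullZ => //; rewrite mulr_ge0// ltW.
have FZ a x : 0 <= a -> F x -> F (a *: x).
  move=> a0 [Kx [t t0 Kt]]; split; first exact: conic_hullZ.
  have a1 : 0 < 1 + a by rewrite ltr_pwDl.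
  exists (t / (1 + a)); first by rewrite divr_gt0.
  have -> : u - (t / (1 + a)) *: (a *: x)
      = (u - t *: x) + (t / (1 + a)) *: x.
    rewrite scalerA -[X in X - t *: x]addr0 -!addrA; congr (_ + _); rewrite add0r.
    rewrite -scaleNr -scaleNr -scalerDl; congr (_ *: _).
    apply/(mulIf (lt0r_neq0 a1)); rewrite mulrDl !mulNr mulrAC !divfK ?lt0r_neq0//.
    by rewrite mulrDr mulr1 opprD addrAC addNr add0r.
  by apply: conic_hullD => //; apply: conic_hullZ => //; rewrite divr_ge0// ltW.
have FD x y : F x -> F y -> F (x + y).
  move=> [Kx [a a0 Ka]] [Ky [b b0 Kb]]; split; first exact: conic_hullD.
  have h0 : 0 < 2^-1 :> R by rewrite invr_gt0.
  pose m := Num.min a b.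
  have m0 : 0 < m by rewrite lt_min a0.
  exists (2^-1 * m); first by rewrite mulr_gt0.
  have key z w : K z -> K (u - w *: z) -> m <= w -> K (u - m *: z).
    move=> Kz Kw mw; have -> : u - m *: z = (u - w *: z) + (w - m) *: z.
      by rewrite scalerBl addrA subrK.
    by apply: conic_hullD => //; apply: conic_hullZ => //; rewrite subr_ge0.
  have -> : u - (2^-1 * m) *: (x + y)
      = 2^-1 *: (u - m *: x) + 2^-1 *: (u - m *: y).
    rewrite -!scalerDr -scalerA addrACA -opprD scalerBr -scalerDr; congr (_ - _).
    by rewrite -[u in u + u]scale1r -scalerDl scalerA mulVf ?scale1r// pnatr_eq0.
  apply: conic_hullD; apply: conic_hullZ; rewrite ?ltW//; apply: key.
  - exact: Kx.
  - exact: Ka.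
  - by rewrite ge_min lexx.
  - exact: Ky.
  - exact: Kb.
  - by rewrite ge_min lexx orbT.
exists F; split.
  split=> //.
    move=> x y l /set_mem Fx /set_mem Fy; apply/mem_set.
    by apply: (FD (l%:num *: x) ((1 - l%:num) *: y)); apply: FZ.
  move=> x y t Kx Ky /andP[t0 t1] Fxy; split; first by apply: ext Fxy; rewrite ?subr_ge0 ?ltW.
  apply: (ext y x (1 - t)) => //; rewrite ?subr_gt0// ?subKr ?ltW//.
  by rewrite addrC.
have Fu : F u by split=> //; exists 1 => //; rewrite scale1r subrr; exact: conic_hull0.
split=> //.
pose Y := [seq g <- s | `[< G g /\ F g >]].
pose X := in_tuple Y.
have FX i : F X`_i.
  have [lt|ge] := ltnP i (size X).
    by have := mem_nth 0 lt; rewrite mem_filter => /andP[/asboolP[_]].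
  rewrite nth_default//; split; first exact: conic_hull0.
  by exists 1 => //; rewrite scaler0 subr0.
have spanF x : F x -> x \in <<X>>%VS.
  move=> [Kx [t t0 Kt]]; case: Kx Kt => n [c [g [cg ->]]] Kt.
  apply: memv_suml => i _; have [c0 Gg] := cg i.
  have [->|ci] := eqVneq (c i) 0; first by rewrite scale0r mem0v.
  apply: memvZ; apply: memv_span; rewrite mem_filter Gs// andbT.
  apply/asboolP; split=> //; split; first exact: conic_hull_gen.
  exists (t * c i); first by rewrite mulr_gt0// lt_def ci.
  have -> : u - (t * c i) *: g i = (u - t *: (\sum_i c i *: g i))
      + t *: (\sum_(j | j != i) c j *: g j).
    by rewrite (bigD1 i)//= scalerDr scalerA opprD addrA subrK.
  apply: conic_hullD => //; apply: conic_hullZ; first exact: ltW.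
  apply: conic_hull_sum => j _; have [? ?] := cg j.
  by apply: conic_hullZ => //; apply: conic_hull_gen.
have [t t0 Kt] : exists2 t : R, 0 < t & K (u - t *: \sum_(i < size Y) X`_i).
  have [] // : F (\sum_(i < size Y) X`_i).
  by apply: big_ind => //; rewrite -[0](scale0r u); apply: FZ.
pose delta (a : T) : V := [ffun b => (b == a)%:R].
have deltaE (v : V) : v = \sum_a v a *: delta a.
  apply/ffunP => b; rewrite sum_ffunE (bigD1 b)//= big1 ?addr0.
    by rewrite !ffunE eqxx /GRing.scale /= mulr1.
  by move=> a ab; rewrite !ffunE eq_sym (negbTE ab) /GRing.scale /= mulr0.
pose M : R := 1 + \sum_(i < size Y) \sum_a `|coord X i (delta a)|.
have M0 : 0 < M by rewrite ltr_pwDl// sumr_ge0// => i _; rewrite sumr_ge0.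
have near v : v \in <<X>>%VS -> (forall a, `|v a| < t / M) -> K (u + v).
  move=> vX vs.
  have cb i : `|coord X i v| <= t.
    rewrite [v]deltaE linear_sum /=.
    apply: le_trans (ler_norm_sum _ _ _) _.
    apply: (@le_trans _ _ (\sum_a t / M * `|coord X i (delta a)|)).
      apply: ler_sum => a _; rewrite linearZ /= normrM ler_wpM2r//; exact: ltW.
    rewrite -mulr_sumr -mulrA ger_pMr// mulrC ler_pdivrMr// mul1r /M.
    rewrite (bigD1 i)//= addrCA lerDl addr_ge0// sumr_ge0// => j _.
    by rewrite sumr_ge0.
  rewrite (coord_span vX).
  have -> : u + \sum_(i < size Y) coord X i v *: X`_i
      = (u - t *: \sum_(i < size Y) X`_i) + \sum_(i < size Y) (t + coord X i v) *: X`_i.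
    rewrite -addrA; congr (_ + _).
    rewrite scaler_sumr -sumrN -big_split; apply: eq_bigr => i _ /=.
    by rewrite scalerDl addrA addNr add0r.
  apply: conic_hullD => //; apply: conic_hull_sum => i _.
  apply: conic_hullZ; last by case: (FX i).
  by have := cb i; rewrite ler_norml => /andP[lb _]; rewrite addrC -lerBlDr sub0r.
exists (t / M); first by rewrite divr_gt0.
move=> y [n [c [p [Fp c1 yE]]]] yu.
have yuX : y - u \in <<X>>%VS.
  apply: memvB; last exact: spanF.
  rewrite yE; apply: memv_suml => i _.
  by apply: memvZ; apply: spanF.
have yuE a : (y - u) a = y a - u a by rewrite !ffunE.
have h0 : 0 < 2^-1 :> R by rewrite invr_gt0.
split.
  have -> : y = u + (y - u) by rewrite addrC subrK.
  by apply: near => // a; rewrite yuE.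
exists 2^-1 => //.
have -> : u - 2^-1 *: y = 2^-1 *: (u + (u - y)).
  by apply/ffunP => a; rewrite !ffunE /GRing.scale /=; field.
apply: conic_hullZ; first exact: ltW.
rewrite -opprB; apply: near; first by rewrite memvN.
by move=> a; rewrite ffunE normrN yuE.
Qed.

End ConicHull.
End ConvexGeometry.

Section Imsets.
Variables (R : realType) (N : finType).
Implicit Types A B C : {set N}.

Local Notation V := {ffun {set N} -> R^o}.

Definition delta A : V := [ffun S => (S == A)%:R].

Definition ci_triple A B C : bool :=
  [&& A != finset.set0, B != finset.set0,
      [disjoint A & B], [disjoint A & C] & [disjoint B & C]].

Definition semi_elementary A B C : V :=
  delta (A :|: B :|: C) + delta C - delta (A :|: C) - delta (B :|: C).

Definition imset_cone : set V :=
  conic_hull [set u | exists A B C, ci_triple A B C /\ u = semi_elementary A B C].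

Definition imset_face A B C : set V :=
  xget set0 [set F | is_face imset_cone F /\ relint F (semi_elementary A B C)].

Definition elementary_imsets A B C : set V :=
  [set u | exists a b (G : {set N}),
     [/\ a \in A, b \in B, C \subset G, G \subset A :|: B :|: C &
         [/\ a \notin G, b \notin G &
             u = semi_elementary [set a]%SET [set b]%SET G]]].

Lemma imset_faceP A B C : ci_triple A B C ->
  unique (fun F => is_face imset_cone F /\ relint F (semi_elementary A B C))
    (imset_face A B C).
Proof.
move=> tABC.
have spec : is_face imset_cone (imset_face A B C) /\
    relint (imset_face A B C) (semi_elementary A B C).
  pose P (F : set V) := is_face imset_cone F /\ relint F (semi_elementary A B C).
  apply: (@xgetPex _ set0 P).
  apply: (@face_exists R {set N} _
    [seq semi_elementary t.1.1 t.1.2 t.2 | t : {set N} * {set N} * {set N}]).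
    by move=> _ [A' [B' [C' [_ ->]]]]; apply/fintype.imageP; exists (A', B', C').
  by apply: conic_hull_gen; exists A, B, C.
split=> // F [fF uF]; case: spec => fG uG.
exact: face_unique fG uG fF uF.
Qed.

End Imsets.

Arguments semi_elementary R {N} A B C.
Arguments imset_cone R N : clear implicits.
Arguments imset_face R {N} A B C _.
Arguments elementary_imsets R {N} A B C _.

(* Main.v *)
(** Every semi-elementary imset is a sum of elementary ones by the chain rule
    u<A,B|C> = u<A,B-b|bC> + u<A,b|C>, and the same rule exhibits each member
    of E<A,B|C> as a summand of u<A,B|C>.  Conversely, the indicators of
    [Z \subset S] and of [S \subset Z] are supermodular functions of S, hence
    nonnegative functionals on the cone, and they separate from u<A,B|C> every
    elementary imset outside E<A,B|C>; so F<A,B|C> is the cone generated by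
    E<A,B|C>.  For a singleton pair this says that F<a,b|G> is a half line,
    which makes each member of E<A,B|C> extreme.  Finally the imsets u<X,Y|C>,
    with X and Y nonempty subsets of A and B, form a basis of the span of
    E<A,B|C>: among them only u<X,Y|C> is nonzero at the set XYC. *)
From HB Require Import structures.
Require Import Defs.
From mathcomp Require Import all_boot all_order all_algebra.
From mathcomp Require Import boolp classical_sets reals.
From mathcomp Require Import interval_inference convex.
From mathcomp Require Import ring lra zify.

Set Implicit Arguments.
Unset Strict Implicit.
Unset Printing Implicit Defensive.

Import Order.TTheory GRing.Theory Num.Theory.

Local Open Scope ring_scope.
Local Open Scope classical_set_scope.

(** * Faces of conic hulls *)

Section ConicHullFaces.
Variables (R : realType) (T : finType).
Local Notation V := {ffun T -> R^o}.
Implicit Types (K G H F : set V) (x y u : V).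

Lemma conic_hull_sub G H : G `<=` conic_hull H -> conic_hull G `<=` conic_hull H.
Proof.
move=> GH _ [n [c [g [cg ->]]]]; apply: conic_hull_sum => i _.
by have [c0 Gg] := cg i; apply: conic_hullZ => //; exact: GH.
Qed.

(** [x + y] is the midpoint of [2 *: x] and [2 *: y]. The factor 2 stays because closure of faces
    under scaling is itself derived from this lemma. *)
Lemma face_add_double G F x y : is_face (conic_hull G) F ->
  conic_hull G x -> conic_hull G y -> F (x + y) -> F (2 *: x).
Proof.
move=> [_ _ ext] Kx Ky Fxy.
have [] // := ext (2 *: x) (2 *: y) 2^-1; [exact: conic_hullZ..| |].
  by apply/andP; split; lra.
suff -> : 2^-1 *: (2 *: x) + (1 - 2^-1) *: (2 *: y) = x + y by [].
by apply/ffunP => t; rewrite !ffunE /GRing.scale /=; field.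
Qed.

(** For [c < 2], [c *: x] is twice a summand of [x]; for [c >= 2], [x] is a proper convex
    combination of [c *: x] and 0. *)
Lemma face_conicZ G F c x : is_face (conic_hull G) F -> 0 <= c -> F x -> F (c *: x).
Proof.
move=> fF c0 Fx; have [_ FK ext] := fF; have Kx := FK _ Fx.
have [c2|c2] := ltP c 2.
  have -> : c *: x = 2 *: ((c / 2) *: x).
    by apply/ffunP => t; rewrite !ffunE /GRing.scale /=; field.
  apply: (face_add_double (y := (1 - c / 2) *: x) fF); try (apply: conic_hullZ => //; lra).
  by rewrite -scalerDl addrC subrK scale1r.
have c_gt0 : 0 < c by lra.
have [] // := ext (c *: x) 0 c^-1; [exact: conic_hullZ|exact: conic_hull0| |].
  by rewrite invr_gt0 c_gt0 invf_lt1//; lra.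
by rewrite scaler0 addr0 scalerA mulVf ?scale1r// gt_eqF.
Qed.

Lemma face_conicD G F x y : is_face (conic_hull G) F ->
  conic_hull G x -> conic_hull G y -> F (x + y) -> F x.
Proof.
move=> fF Kx Ky Fxy; have F2 := face_add_double fF Kx Ky Fxy.
rewrite -[x]scale1r -(@mulVf _ (2 : R))// -scalerA.
by apply: (face_conicZ fF) => //; lra.
Qed.

(** A term with nonzero coefficient is a summand of the whole sum, and scaling it back stays in the
    face. *)
Lemma face_conic_gen G F (n : nat) (c : 'I_n -> R) (g : 'I_n -> V) (i : 'I_n) :
  is_face (conic_hull G) F -> (forall j, 0 <= c j /\ G (g j)) ->
  F (\sum_j c j *: g j) -> c i != 0 -> F (g i).
Proof.
move=> fF cg Fs ci0.
have Kcg j : conic_hull G (c j *: g j).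
  by have [c0 Gg] := cg j; apply: conic_hullZ => //; exact: conic_hull_gen.
have Fi : F (c i *: g i).
  move: Fs; rewrite (bigD1 i)//=; apply: (face_conicD fF) => //.
  by apply: conic_hull_sum => j _.
rewrite -[g i]scale1r -(mulVf ci0) -scalerA; apply: (face_conicZ fF) => //.
by rewrite invr_ge0; case: (cg i).
Qed.

Lemma face_conic_add_closed G F x y : is_face (conic_hull G) F -> F x -> F y -> F (x + y).
Proof.
move=> fF Fx Fy; have [cvx _ _] := fF.
have -> : x + y = 2^-1 *: (2 *: x) + (1 - 2^-1) *: (2 *: y).
  by apply/ffunP => t; rewrite !ffunE /GRing.scale /=; field.
have h01 : 0 <= (2^-1 : R) <= 1 by apply/andP; split; lra.
apply: set_mem.
by apply: (cvx _ _ (Itv01 (andP h01).1 (andP h01).2)); apply/mem_set;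
  apply: (face_conicZ fF).
Qed.

Lemma conic_hull_sub_face G H F :
  is_face (conic_hull G) F -> F !=set0 -> H `<=` F -> conic_hull H `<=` F.
Proof.
move=> fF [z Fz] HF _ [n [c [h [ch ->]]]].
apply: big_ind => [|x y|i _].
- by rewrite -(scale0r z); apply: (face_conicZ fF).
- exact: (face_conic_add_closed fF).
- by have [c0 /HF] := ch i; exact: (face_conicZ fF).
Qed.

(** A relatively interior [u] can be pushed slightly away from [x] without leaving [F]; dividing the
    result by [1 + d] exhibits a multiple of [x] as a summand of [u]. *)
Lemma relint_face_sub G F u x : is_face (conic_hull G) F -> relint F u -> F x ->
  exists2 t, 0 < t & conic_hull G (u - t *: x).
Proof.
move=> [_ FK _] [Fu [e e0 He]] Fx.
(* [M] exceeds every coordinate of [u - x] in absolute value, so [d = e / M] moves each coordinate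
   of [u] by less than [e]. *)
pose M := 1 + \sum_t `|u t - x t|.
have M0 : 0 < M by rewrite ltr_wpDr// sumr_ge0.
pose d := e / M.
have d0 : 0 < d by rewrite divr_gt0.
have d1 : 0 < 1 + d by rewrite addr_gt0.
have Fz : F ((1 + d) *: u - d *: x).
  apply: He => [|t].
    exists 2%N, (fun i => if i == 0 then 1 + d else - d),
      (fun i => if i == 0 then u else x); split=> [i||].
    - by case: ifP.
    - by rewrite !big_ord_recl big_ord0 /=; ring.
    - by rewrite !big_ord_recl big_ord0 /= addr0 scaleNr.
  have -> : ((1 + d) *: u - d *: x) t - u t = d * (u t - x t).
    by rewrite !ffunE /GRing.scale /=; ring.
  rewrite normrM gtr0_norm// /d mulrAC ltr_pdivrMr// ltr_pM2l//.
  by rewrite /M (bigD1 t)//= ltr_pwDl// lerDl sumr_ge0.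
exists (d / (1 + d)); first by rewrite divr_gt0.
have -> : u - (d / (1 + d)) *: x = (1 + d)^-1 *: ((1 + d) *: u - d *: x).
  by apply/ffunP => t; rewrite !ffunE /GRing.scale /=; field; exact: lt0r_neq0.
by apply: conic_hullZ; [rewrite invr_ge0 ltW|exact: FK].
Qed.

Lemma half_lineZ u c : 0 < c -> half_line (c *: u) = half_line u.
Proof.
move=> c0; apply/seteqP; split=> _ [a /= a0 <-].
  by exists (a * c) => /=; [rewrite mulr_ge0// ltW|rewrite scalerA].
exists (a / c) => /=; first by rewrite divr_ge0// ltW.
by rewrite scalerA divfK// gt_eqF.
Qed.

Lemma conic_hull1 u : conic_hull [set u] = half_line u.
Proof.
apply/seteqP; split=> [_ [n [c [g [cg ->]]]]|_ [c /= c0 <-]].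
  exists (\sum_i c i) => /=; first by apply: sumr_ge0 => i _; case: (cg i).
  by rewrite scaler_suml; apply: eq_bigr => i _; case: (cg i) => _ /= ->.
by apply: conic_hullZ => //; exact: conic_hull_gen.
Qed.

Lemma face_sub K F F' : is_face K F -> F `<=` F' -> F' `<=` K -> is_face F' F.
Proof. by move=> [cvx _ ext] FF' F'K; split=> // x y t /F'K Kx /F'K; exact: ext. Qed.

(** The vectors of [s] are asked to lie in the hull only, so that the dimension can be read off a
    basis not drawn from [H]. *)
Lemma linear_span_conic_hull H (s : seq V) :
  H `<=` [set` <<s>>%VS] ->
  (forall x, x \in s -> conic_hull H x) -> linear_span (conic_hull H) = <<s>>%VS.
Proof.
move=> Hs sH; have [KU minU] := linear_spanP (conic_hull H).
apply/eqP; rewrite eqEsubv; apply/andP; split.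
  apply: minU => _ [n [c [h [ch ->]]]] /=; apply: memv_suml => i _.
  by apply: memvZ; have [_ /Hs] := ch i.
by apply/span_subvP => x /sH /KU.
Qed.

End ConicHullFaces.

Section ImsetFaces.
Variables (R : realType) (N : finType).
Local Notation V := {ffun {set N} -> R^o}.
Local Notation imset := (semi_elementary R).
Implicit Types (A B C D G X Y Z S : {set N}) (P : pred {set N}).

(** * Chain rule and decomposition into elementary imsets *)

Lemma disjointsU A B C :
  [disjoint A & C]%B -> [disjoint B & C]%B -> [disjoint A :|: B & C]%B.
Proof.
by rewrite -!finset.setI_eq0 finset.setIUl => /eqP -> /eqP ->; rewrite finset.setU0.
Qed.

Lemma semi_elementaryC A B C : imset A B C = imset B A C.
Proof. by rewrite /semi_elementary (finset.setUC A B) addrAC. Qed.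

Lemma elementary_imsetsC A B C : elementary_imsets R A B C `<=` elementary_imsets R B A C.
Proof.
move=> _ [a [b [G [aA bB CG GABC [aG bG ->]]]]].
by exists b, a, G; split=> //; [rewrite (finset.setUC B)|rewrite semi_elementaryC].
Qed.

Lemma semi_elementary0 A C : imset A finset.set0 C = 0.
Proof.
by rewrite /semi_elementary finset.setU0 finset.set0U addrAC addrK subrr.
Qed.

Lemma semi_elementary_chain A B D C :
  imset A (B :|: D) C = imset A B (D :|: C) + imset A D C.
Proof.
rewrite /semi_elementary !finset.setUA; apply/ffunP => S; rewrite !ffunE.
ring.
Qed.

Lemma elementary_imsetsS A B C A' B' C' :
  A' \subset A -> B' \subset B -> C \subset C' ->
  A' :|: B' :|: C' \subset A :|: B :|: C ->
  elementary_imsets R A' B' C' `<=` elementary_imsets R A B C.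
Proof.
move=> sA sB sC sU _ [a [b [G [aA bB CG GU [aG bG ->]]]]].
exists a, b, G; split=> //.
- exact: (fintype.subsetP sA).
- exact: (fintype.subsetP sB).
- exact: fintype.subset_trans CG.
- exact: fintype.subset_trans sU.
Qed.

Lemma conic_hullS (H H' : set V) : H `<=` H' -> conic_hull H `<=` conic_hull H'.
Proof. by move=> HH'; apply: conic_hull_sub => x /HH'; exact: conic_hull_gen. Qed.

(* The sets A and B may be empty here: the imset is then 0. *)
Lemma semi_elementary_conic A B C :
  [disjoint A & B]%B -> [disjoint A & C]%B -> [disjoint B & C]%B ->
  conic_hull (elementary_imsets R A B C) (imset A B C).
Proof.
have [n le_n] := ubnP (#|A| + #|B|)%N.
elim: n => // n IHn in A B C le_n *.
(* Symmetry makes [B] the larger set: if it has at most one element, then both sets are singletons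
   or one is empty; otherwise an element is split off from it. *)
wlog le_AB : A B le_n / (#|A| <= #|B|)%N => [hwlog dAB dAC dBC|dAB dAC dBC].
  have [|/ltnW] := leqP #|A| #|B|; first by move/hwlog; apply.
  move=> /hwlog; rewrite addnC disjoint_sym semi_elementaryC => /(_ le_n dAB dBC dAC).
  by apply: conic_hullS; exact: elementary_imsetsC.
have [->|[b bB]] := set_0Vmem B.
  by rewrite semi_elementary0; exact: conic_hull0.
have [A0|[a aA]] := set_0Vmem A.
  by rewrite A0 semi_elementaryC semi_elementary0; exact: conic_hull0.
have bA : b \notin A by apply: contraL bB => /(disjointFr dAB) ->.
have bC : b \notin C by rewrite (disjointFr dBC).
have [B1|B_gt1] := leqP #|B| 1.
  have AE : A = [set a]%SET.
    by apply/esym/eqP; rewrite eqEcard finset.sub1set aA cards1 (leq_trans le_AB).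
  have BE : B = [set b]%SET by apply/esym/eqP; rewrite eqEcard finset.sub1set bB cards1.
  apply: conic_hull_gen; exists a, b, C; split=> //; first exact: finset.subsetUr.
  by rewrite (disjointFr dAC aA) bC AE BE.
have BE : B = (B :\ b) :|: [set b]%SET by rewrite finset.setUC finset.setD1K.
have cB : #|B| = (#|B :\ b|).+1 by rewrite (cardsD1 b) bB.
rewrite {2}BE semi_elementary_chain; apply: conic_hullD.
- have dAb : [disjoint A & [set b]%SET]%B by rewrite disjoint_sym disjoints1.
  have dBb : [disjoint B :\ b & [set b]%SET]%B.
    by rewrite disjoint_sym disjoints1 !inE eqxx.
  apply: (@conic_hullS (elementary_imsets R A (B :\ b) ([set b]%SET :|: C))).
    apply: elementary_imsetsS => //; [exact: subD1set|exact: finset.subsetUr|].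
    by rewrite finset.setUA -(finset.setUA A) -BE.
  apply: IHn.
  + by rewrite cB addnS in le_n.
  + exact: disjointWr (subD1set _ _) dAB.
  + by rewrite disjoint_sym disjointsU// disjoint_sym.
  + by rewrite disjoint_sym disjointsU// disjoint_sym// (disjointWl (subD1set _ _) dBC).
- have b_sub : [set b]%SET \subset B by rewrite finset.sub1set.
  apply: (@conic_hullS (elementary_imsets R A [set b]%SET C)).
    by apply: elementary_imsetsS => //; rewrite finset.setSU// finset.setUS.
  apply: IHn => //.
  (* Replacing [B] by a singleton lowers the measure because [B] has at least two elements. *)
  + by rewrite cards1 addn1; move: le_n B_gt1; rewrite !ltnS; lia.
  + exact: disjointWr dAB.
  + exact: disjointWl dBC.
Qed.

(** This form covers the empty pieces that splittings by the chain rule produce; their imset is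
    0. *)
Lemma semi_elementary_cone A B C :
  [disjoint A & B]%B -> [disjoint A & C]%B -> [disjoint B & C]%B ->
  imset_cone R N (imset A B C).
Proof.
move=> dAB dAC dBC.
have [->|B0] := eqVneq B finset.set0; first by rewrite semi_elementary0; exact: conic_hull0.
have [->|A0] := eqVneq A finset.set0.
  by rewrite semi_elementaryC semi_elementary0; exact: conic_hull0.
by apply: conic_hull_gen; exists A, B, C; rewrite /ci_triple A0 B0 dAB dAC dBC.
Qed.

(** * Elementary summands of a semi-elementary imset *)

(** Cutting [B] into B-bY, b and Y, two chain rules give u<A,B|C> = u<A,B-bY|bYC> + u<A,b|YC> +
    u<A,Y|C>. *)
Lemma summand_semi_elementary A B C b Y :
  [disjoint A & B]%B -> [disjoint A & C]%B -> [disjoint B & C]%B ->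
  b \in B -> Y \subset B -> b \notin Y ->
  imset_cone R N (imset A B C - imset A [set b]%SET (Y :|: C)).
Proof.
move=> dAB dAC dBC bB YB bY.
have bYB : [set b]%SET :|: Y \subset B by rewrite finset.subUset finset.sub1set bB.
have BE : B = (B :\: ([set b]%SET :|: Y)) :|: ([set b]%SET :|: Y).
  by rewrite -[LHS](setID _ ([set b]%SET :|: Y)) (finset.setIidPr bYB) finset.setUC.
have dAY : [disjoint A & Y]%B by exact: disjointWr YB dAB.
have dAb : [disjoint A & [set b]%SET]%B by apply: disjointWr dAB; rewrite finset.sub1set.
have -> : imset A B C - imset A [set b]%SET (Y :|: C) =
    imset A (B :\: ([set b]%SET :|: Y)) (([set b]%SET :|: Y) :|: C) + imset A Y C.
  rewrite {1}BE semi_elementary_chain (semi_elementary_chain A [set b]%SET).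
  by rewrite -addrA [X in _ + X]addrAC subrr add0r.
apply: conic_hullD; apply: semi_elementary_cone => //.
- exact: disjointWr (subsetDl _ _) dAB.
- by rewrite disjoint_sym !disjointsU// disjoint_sym.
- rewrite disjoint_sym disjointsU//.
    rewrite -finset.setI_eq0; apply/eqP/finset.setP => x; rewrite !inE.
    by case: (x == b); case: (x \in Y).
  by rewrite disjoint_sym; exact: disjointWl (subsetDl _ _) dBC.
- exact: disjointWl YB dBC.
Qed.

Lemma setI_decomp A B C G : C \subset G -> G \subset A :|: B :|: C ->
  G = G :&: A :|: (G :&: B :|: C).
Proof.
move=> CG GU; apply/finset.setP => x; rewrite !inE.
have := fintype.subsetP CG x; have := fintype.subsetP GU x; rewrite !inE.
by case: (x \in G); case: (x \in A); case: (x \in B); case: (x \in C) => //= h1 h2;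
  rewrite ?(h1 isT) ?(h2 isT).
Qed.

Lemma summand_elementary A B C e : ci_triple A B C -> elementary_imsets R A B C e ->
  imset_cone R N (imset A B C - e).
Proof.
case/and5P=> _ _ dAB dAC dBC [a [b [G [aA bB CG GU [aG bG ->]]]]].
pose X := G :&: A; pose Y := G :&: B.
have XA : X \subset A by exact: finset.subsetIr.
have YB : Y \subset B by exact: finset.subsetIr.
have GE : G = X :|: (Y :|: C) by exact: setI_decomp.
have aX : a \notin X by rewrite !inE (negbTE aG).
have bY : b \notin Y by rewrite !inE (negbTE bG).
have bA : [disjoint [set b]%SET & A]%B by rewrite disjoints1 (disjointFl dAB).
have bYC : [disjoint [set b]%SET & Y :|: C]%B.
  by rewrite disjoints1 !inE negb_or (negbTE bG) (disjointFr dBC).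
have AYC : [disjoint A & Y :|: C]%B.
  by rewrite disjoint_sym disjointsU// disjoint_sym//; exact: disjointWr YB dAB.
(* The passage from u<A,B|C> to u<a,b|G> goes through u<A,b|YC>: first [B] is cut down to [b], then,
   by symmetry, [A] to [a]. *)
rewrite -(subrKA (imset A [set b]%SET (Y :|: C))); apply: conic_hullD.
  exact: summand_semi_elementary.
rewrite GE (semi_elementaryC A) (semi_elementaryC [set a]%SET).
exact: summand_semi_elementary.
Qed.

(** * Supermodular functionals on the imset cone *)

Definition mass P (x : V) : R^o := \sum_(S | P S) x S.

Lemma mass_is_linear P : linear (mass P).
Proof.
move=> c x y; rewrite /mass scaler_sumr -big_split /=.
by apply: eq_bigr => S _; rewrite !ffunE.
Qed.

HB.instance Definition _ P :=
  GRing.isLinear.Build R V R^o _ (mass P) (mass_is_linear P).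

Lemma mass_delta P A : mass P (delta R A) = (P A)%:R.
Proof.
rewrite /mass; under eq_bigr do rewrite ffunE.
case PA: (P A).
  by rewrite (bigD1 A)//= eqxx big1 ?addr0// => S /andP[_ /negbTE ->].
by rewrite big1// => S PS; case: eqP => // SA; rewrite SA PA in PS.
Qed.

Lemma mass_semi_elementary P A B C : mass P (imset A B C) =
  (P (A :|: B :|: C))%:R + (P C)%:R - (P (A :|: C))%:R - (P (B :|: C))%:R.
Proof. by rewrite /semi_elementary !linearB linearD /= !mass_delta. Qed.

Definition supermodular P :=
  forall X Y, (P X + P Y <= P (X :|: Y) + P (X :&: Y))%N.

(** On a generator the value is the supermodular inequality at AC and BC: their union is ABC, and
    their intersection is C because [A] and [B] are disjoint. *)
Lemma mass_ge0 P x : supermodular P -> imset_cone R N x -> 0 <= mass P x.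
Proof.
move=> supP [n [c [g [cg ->]]]]; rewrite linear_sum sumr_ge0// => i _.
rewrite linearZ /=; have [c0 [A [B [C [/and5P[_ _ dAB dAC dBC] ->]]]]] := cg i.
rewrite mulr_ge0// mass_semi_elementary.
have := supP (A :|: C) (B :|: C).
rewrite finset.setUACA finset.setUid -finset.setUIl.
have /eqP -> : A :&: B == finset.set0 by rewrite finset.setI_eq0.
rewrite finset.set0U -(ler_nat R) !natrD; lra.
Qed.

Lemma supermodular_above Z : supermodular [pred S : {set N} | Z \subset S].
Proof.
move=> X Y /=; rewrite finset.subsetI.
case: (boolP (Z \subset X)) => [ZX|_]; case: (boolP (Z \subset Y)) => [ZY|_] //=.
- by rewrite (fintype.subset_trans ZX)// finset.subsetUl.
- by rewrite (fintype.subset_trans ZX)// finset.subsetUl.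
- by rewrite (fintype.subset_trans ZY)// finset.subsetUr.
Qed.

Lemma supermodular_below Z : supermodular [pred S : {set N} | S \subset Z].
Proof.
move=> X Y /=; rewrite finset.subUset.
case: (boolP (X \subset Z)) => [XZ|_]; case: (boolP (Y \subset Z)) => [YZ|_] //=.
- by rewrite (fintype.subset_trans _ XZ)// finset.subsetIl.
- by rewrite (fintype.subset_trans _ XZ)// finset.subsetIl.
- by rewrite (fintype.subset_trans _ YZ)// finset.subsetIr.
Qed.

(** * Separating the other elementary imsets *)

(** The mass of [u - t *: x] is -t times that of [x]. Used by contraposition: a functional equal to
    1 at [x] cannot vanish at [u]. *)
Lemma mass_summand_le0 P t u x : supermodular P -> 0 < t ->
  imset_cone R N (u - t *: x) -> mass P u = 0 -> mass P x <= 0.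
Proof.
move=> supP t0 /(mass_ge0 supP); rewrite linearB linearZ /= => + u0.
by rewrite u0 sub0r oppr_ge0 pmulr_rle0.
Qed.

(** The functional of supersets of [Z] sees only the set abG in u<a,b|G>, so it is 1 there and
    cannot vanish at u<A,B|C>. *)
Lemma summand_above A B C a b G Z t : ci_triple A B C -> 0 < t ->
  imset_cone R N (imset A B C - t *: imset [set a]%SET [set b]%SET G) ->
  a \notin G -> b \notin G -> a != b ->
  [set a; b]%SET \subset Z -> Z \subset [set a; b]%SET :|: G ->
  [/\ Z \subset A :|: B :|: C, ~~ (Z \subset A :|: C) & ~~ (Z \subset B :|: C)].
Proof.
case/and5P=> _ _ dAB dAC dBC t0 Ke aG bG ab abZ Zab.
have [aZ bZ] : a \in Z /\ b \in Z.
  by split; apply: (fintype.subsetP abZ); rewrite !inE eqxx ?orbT.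
have sub0 : mass [pred S : {set N} | Z \subset S] (imset [set a]%SET [set b]%SET G) = 1.
  rewrite mass_semi_elementary /= Zab.
  have -> : (Z \subset G) = false by apply: contraNF aG => /fintype.subsetP; apply.
  have -> : (Z \subset [set a]%SET :|: G) = false.
    by apply: contraNF bG => /fintype.subsetP /(_ _ bZ); rewrite !inE eq_sym (negbTE ab).
  have -> : (Z \subset [set b]%SET :|: G) = false.
    by apply: contraNF aG => /fintype.subsetP /(_ _ aZ); rewrite !inE (negbTE ab).
  by rewrite addr0 !subr0.
have : mass [pred S : {set N} | Z \subset S] (imset A B C) <> 0.
  by move/(mass_summand_le0 (@supermodular_above Z) t0 Ke); rewrite sub0 ler10.
(* As [A] and [B] are disjoint, [Z] lies in C exactly when it lies in AC and in BC. The value is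
   then 0 unless [Z] lies in ABC but in neither of these. *)
have -> : mass [pred S : {set N} | Z \subset S] (imset A B C) =
    (Z \subset A :|: B :|: C)%:R + ((Z \subset A :|: C) && (Z \subset B :|: C))%:R
    - (Z \subset A :|: C)%:R - (Z \subset B :|: C)%:R.
  rewrite mass_semi_elementary /= -finset.subsetI -finset.setUIl.
  have /eqP -> : A :&: B == finset.set0 by rewrite finset.setI_eq0.
  by rewrite finset.set0U.
have AU : Z \subset A :|: C -> Z \subset A :|: B :|: C.
  by move/fintype.subset_trans; apply; rewrite finset.setSU// finset.subsetUl.
have BU : Z \subset B :|: C -> Z \subset A :|: B :|: C.
  by move/fintype.subset_trans; apply; rewrite finset.setSU// finset.subsetUr.
move: AU BU; case: (Z \subset A :|: C); case: (Z \subset B :|: C);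
  case: (Z \subset A :|: B :|: C) => AU BU;
  by [have := AU isT|have := BU isT|split|case; rewrite /=; ring].
Qed.

(** If [C] were not inside [G], the functional of subsets of [G] would be 0 at u<A,B|C>, yet it is 1
    at u<a,b|G>, where only [G] counts. *)
Lemma summand_below A B C a b G t : 0 < t ->
  imset_cone R N (imset A B C - t *: imset [set a]%SET [set b]%SET G) ->
  a \notin G -> b \notin G -> C \subset G.
Proof.
move=> t0 Ke aG bG; apply/negPn/negP => CG.
have := mass_summand_le0 (@supermodular_below G) t0 Ke.
rewrite !mass_semi_elementary /= !finset.subUset !finset.sub1set.
rewrite (negbTE CG) (negbTE aG) (negbTE bG) !andbF subxx /=.
by rewrite !add0r !subr0 oppr0 ler10 => /(_ erefl).
Qed.

Lemma summand_elementaryP A B C a b G t : ci_triple A B C ->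
  ci_triple [set a]%SET [set b]%SET G -> 0 < t ->
  imset_cone R N (imset A B C - t *: imset [set a]%SET [set b]%SET G) ->
  elementary_imsets R A B C (imset [set a]%SET [set b]%SET G).
Proof.
move=> tABC /and5P[_ _ + + +] t0 Ke.
rewrite !disjoints1 inE => ab aG bG.
have CG := summand_below t0 Ke aG bG.
have above := summand_above tABC t0 Ke aG bG ab.
(* Taking abG for [Z] places [G] inside ABC; taking ab puts one of [a], [b] in [A] and the other in
   [B], since neither lies in [C]. *)
have [GU _ _] := above _ (finset.subsetUl _ G) (fintype.subxx _).
have [abU abA abB] := above _ (fintype.subxx _) (finset.subsetUl _ G).
have {}GU : G \subset A :|: B :|: C by apply: fintype.subset_trans GU; exact: finset.subsetUr.
have aC : a \notin C by apply: contra aG; exact: (fintype.subsetP CG).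
have bC : b \notin C by apply: contra bG; exact: (fintype.subsetP CG).
move: abU abA abB; rewrite !finset.subUset !finset.sub1set !inE (negbTE aC) (negbTE bC) !orbF.
move=> /andP[/orP[aA|aB] /orP[bA|bB]]; rewrite ?aA ?bA ?aB ?bB ?andbT //= => nA nB.
  by exists a, b, G.
by exists b, a, G; split=> //; rewrite semi_elementaryC.
Qed.

Lemma elementary_ci_triple A B C a b G : ci_triple A B C -> a \in A -> b \in B ->
  a \notin G -> b \notin G -> ci_triple [set a]%SET [set b]%SET G.
Proof.
case/and5P=> _ _ dAB _ _ aA bB aG bG.
rewrite /ci_triple -!card_gt0 !cards1 !disjoints1 aG bG !andbT /=.
by rewrite inE; apply: contraTneq bB => <-; rewrite (disjointFr dAB).
Qed.

(** * The face as a cone over elementary imsets *)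

(** With elementary generators, [face_conic_gen] writes each element of a face through elementary
    imsets of that same face. *)
Lemma imset_cone_elementary : imset_cone R N =
  conic_hull [set e | exists a b G,
    ci_triple [set a]%SET [set b]%SET G /\ e = imset [set a]%SET [set b]%SET G].
Proof.
apply/seteqP; split; last first.
  by apply: conic_hullS => _ [a [b [G [tG ->]]]]; exists [set a]%SET, [set b]%SET, G.
apply: conic_hull_sub => _ [A [B [C [tABC ->]]]].
have /and5P[_ _ dAB dAC dBC] := tABC.
apply: conic_hullS (semi_elementary_conic dAB dAC dBC).
move=> _ [a [b [G [aA bB _ _ [aG bG ->]]]]]; exists a, b, G; split=> //.
exact: elementary_ci_triple tABC aA bB aG bG.
Qed.

(** An elementary imset in the face is, up to scaling, a summand of the relatively interior
    u<A,B|C>, hence in E<A,B|C>. Conversely, members of E<A,B|C> are summands of u<A,B|C>, and a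
    face contains the summands of its elements. *)
Lemma imset_faceE A B C : ci_triple A B C ->
  imset_face R A B C = conic_hull (elementary_imsets R A B C).
Proof.
move=> tABC; have [[fF uF] _] := imset_faceP R tABC.
have [Fu _] := uF; have [_ FK _] := fF.
apply/seteqP; split.
  move=> x Fx; have := FK _ Fx; rewrite imset_cone_elementary => -[n [c [g [cg xE]]]].
  rewrite xE; apply: conic_hull_sum => i _; have [c0 [a [b [G [tG gE]]]]] := cg i.
  have [->|ci0] := eqVneq (c i) 0; first by rewrite scale0r; exact: conic_hull0.
  apply: conic_hullZ => //; apply: conic_hull_gen.
  have Fg : imset_face R A B C (g i).
    move: (fF); rewrite imset_cone_elementary => fF'.
    by apply: (face_conic_gen fF' cg) ci0; rewrite -xE.
  have [t t0 Kt] := relint_face_sub fF uF Fg.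
  by rewrite gE in Kt *; exact: summand_elementaryP tABC tG t0 Kt.
apply: (conic_hull_sub_face fF); first by exists (imset A B C).
move=> e Ee; apply: (face_conicD fF (y := imset A B C - e)).
- have [a [b [G [aA bB _ _ [aG bG ->]]]]] := Ee.
  apply: conic_hull_gen; exists [set a]%SET, [set b]%SET, G; split=> //.
  exact: elementary_ci_triple tABC aA bB aG bG.
- exact: summand_elementary.
- by rewrite addrC subrK.
Qed.

(** * Extreme rays of the face *)

(** The functional of subsets of [C] has value 1: [A] and [B], non-empty and disjoint from [C],
    leave only the term at [C]. *)
Lemma semi_elementary_neq0 A B C : ci_triple A B C -> imset A B C != 0.
Proof.
case/and5P=> A0 B0 dAB dAC dBC; apply/eqP => /(congr1 (mass [pred S : {set N} | S \subset C])).
rewrite mass_semi_elementary linear0 /= !finset.subUset fintype.subxx !andbT.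
have -> : (A \subset C) = false.
  by apply: contraNF A0 => /finset.setIidPl <-; rewrite finset.setI_eq0.
have -> : (B \subset C) = false.
  by apply: contraNF B0 => /finset.setIidPl <-; rewrite finset.setI_eq0.
by rewrite add0r !subr0 => /eqP; rewrite oner_eq0.
Qed.

Lemma elementary_imsets1 a b G : a \notin G -> b \notin G ->
  elementary_imsets R [set a]%SET [set b]%SET G = [set imset [set a]%SET [set b]%SET G].
Proof.
move=> aG bG; apply/seteqP; split=> [e|_ ->].
  case=> a' [b' [H [/set1P-> /set1P-> GH HU [aH bH ->]]]].
  suff -> : H = G by [].
  apply/eqP; rewrite finset.eqEsubset GH andbT; apply/fintype.subsetP => x xH.
  have := fintype.subsetP HU _ xH; rewrite !inE => /orP[/orP[]|//] /eqP xE.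
    by rewrite -xE xH in aH.
  by rewrite -xE xH in bH.
by exists a, b, G; split; rewrite ?inE//; exact: finset.subsetUr.
Qed.

Lemma imset_face1 a b G : ci_triple [set a]%SET [set b]%SET G ->
  imset_face R [set a]%SET [set b]%SET G = half_line (imset [set a]%SET [set b]%SET G).
Proof.
move=> tG; have /and5P[_ _ _ aG bG] := tG; rewrite !disjoints1 in aG bG.
by rewrite imset_faceE// elementary_imsets1// conic_hull1.
Qed.

Lemma imset_face_extreme_ray A B C (r : set V) : ci_triple A B C ->
  extreme_ray (imset_face R A B C) r <->
  exists2 u, elementary_imsets R A B C u & r = half_line u.
Proof.
move=> tABC; split.
  rewrite imset_faceE// => -[fr [v v0 rE]].
  have rv : r v by rewrite rE; exists 1 => //=; rewrite scale1r.
  have [_ rF _] := fr; have [n [c [g [cg vE]]]] := rF _ rv.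
  (* Since [v] is nonzero, some generator occurs in it with nonzero coefficient; this generator lies
     on the ray and, being nonzero, spans it. *)
  have [i ci0] : exists i, c i != 0.
    apply/existsP; apply: contraNT v0; rewrite negb_exists => /forallP c0.
    by rewrite vE big1// => i _; move/negPn/eqP: (c0 i) => ->; rewrite scale0r.
  have rg : r (g i) by apply: (face_conic_gen fr cg) ci0; rewrite -vE.
  have [_ Eg] := cg i; exists (g i) => //.
  move: rg; rewrite rE => -[d /= d0 dE].
  rewrite -dE half_lineZ// lt_neqAle d0 andbT eq_sym; apply/eqP => d_eq0.
  have [a [b [G [aA bB _ _ [aG bG gE]]]]] := Eg.
  have := semi_elementary_neq0 (elementary_ci_triple tABC aA bB aG bG).
  by rewrite -gE -dE d_eq0 scale0r eqxx.
move=> [e Ee ->]; have [a [b [G [aA bB _ _ [aG bG eE]]]]] := Ee.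
have tG := elementary_ci_triple tABC aA bB aG bG.
split; last by exists e => //; rewrite eE semi_elementary_neq0.
(* The half line is F<a,b|G>, a face of the whole cone, hence also a face of the smaller cone
   F<A,B|C> that contains it. *)
have [[fG _] _] := imset_faceP R tG.
have [[[_ FK _] _] _] := imset_faceP R tABC.
rewrite imset_face1// -eE in fG; apply: (face_sub fG _ FK).
rewrite imset_faceE// => _ [c /= c0 <-].
by apply: conic_hullZ => //; exact: conic_hull_gen.
Qed.

(** * Dimension of the face *)

Definition subset_pairs A B : {set {set N} * {set N}} :=
  finset.setX (powerset A :\ finset.set0) (powerset B :\ finset.set0).

Lemma card_subset_pairs A B :
  #|subset_pairs A B| = ((2 ^ #|A| - 1) * (2 ^ #|B| - 1))%N.
Proof.
have card0 X : #|powerset X :\ finset.set0| = (2 ^ #|X| - 1)%N.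
  by rewrite -card_powerset [in RHS](cardsD1 finset.set0) powersetE finset.sub0set addKn.
by rewrite cardsX !card0.
Qed.

Lemma subset_pairsP A B p : reflect
  [/\ p.1 != finset.set0, p.1 \subset A, p.2 != finset.set0 & p.2 \subset B]
  (p \in subset_pairs A B).
Proof.
apply: (iffP idP); case: p => X Y; rewrite !inE /=; last by case=> -> -> -> ->.
by case/andP=> /andP[? ?] /andP[].
Qed.

Definition subset_imsets A B C : seq V :=
  [seq imset p.1 p.2 C | p <- enum (subset_pairs A B)].

(** [X] and [Y] are recovered as the traces of XYC on [A] and [B]. *)
Lemma eq_disjoint_setU A B C X Y X' Y' :
  [disjoint A & B]%B -> [disjoint A & C]%B -> [disjoint B & C]%B ->
  X \subset A -> Y \subset B -> X' \subset A -> Y' \subset B ->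
  (X :|: Y :|: C == X' :|: Y' :|: C) = (X == X') && (Y == Y').
Proof.
move=> dAB dAC dBC XA YB X'A Y'B.
have trA (U W : {set N}) : U \subset A -> W \subset B -> (U :|: W :|: C) :&: A = U.
  move=> UA WB; rewrite !finset.setIUl (finset.setIidPl UA).
  have /eqP -> : W :&: A == finset.set0.
    by rewrite finset.setI_eq0 disjoint_sym (disjointWr WB).
  have /eqP -> : C :&: A == finset.set0 by rewrite finset.setI_eq0 disjoint_sym.
  by rewrite !finset.setU0.
have trB (U W : {set N}) : U \subset A -> W \subset B -> (U :|: W :|: C) :&: B = W.
  move=> UA WB; rewrite !finset.setIUl (finset.setIidPl WB).
  have /eqP -> : U :&: B == finset.set0.
    by rewrite finset.setI_eq0 (disjointWl UA).
  have /eqP -> : C :&: B == finset.set0 by rewrite finset.setI_eq0 disjoint_sym.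
  by rewrite finset.setU0 finset.set0U.
apply/eqP/andP => [E|[/eqP -> /eqP ->]//]; split; apply/eqP.
  by rewrite -(trA X Y)// E trA.
by rewrite -(trB X Y)// E trB.
Qed.

Lemma semi_elementary_coord A B C p q : ci_triple A B C ->
  p \in subset_pairs A B -> q \in subset_pairs A B ->
  imset p.1 p.2 C (q.1 :|: q.2 :|: C) = (q == p)%:R.
Proof.
case/and5P=> _ _ dAB dAC dBC.
case: p q => [X Y] [X' Y'] /subset_pairsP[/= X0 XA Y0 YB] /subset_pairsP[/= X'0 X'A Y'0 Y'B].
have eqU := eq_disjoint_setU dAB dAC dBC X'A Y'B.
have e0 (D : {set N}) : finset.set0 \subset D by exact: finset.sub0set.
rewrite !ffunE eqU//.
(* C, XC and YC are read as unions with the empty set in place of [X] or [Y], so [eqU] separates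
   them from X'Y'C. *)
have := eqU _ _ (e0 A) (e0 B); rewrite !finset.set0U (negbTE X'0) => ->.
have := eqU _ _ XA (e0 B); rewrite !finset.setU0 (negbTE Y'0) andbF => ->.
have := eqU _ _ (e0 A) YB; rewrite !finset.set0U (negbTE X'0) => ->.
by rewrite addr0 !subr0.
Qed.

Lemma free_subset_imsets A B C : ci_triple A B C -> free (subset_imsets A B C).
Proof.
move=> tABC.
pose p i := nth (finset.set0, finset.set0) (enum (subset_pairs A B)) i.
have sz : size (subset_imsets A B C) = size (enum (subset_pairs A B)) by rewrite size_map.
apply/(@freeP _ _ _ (in_tuple (subset_imsets A B C))) => k sum0 i.
have lt_s (j : 'I_(size (subset_imsets A B C))) : (j < size (enum (subset_pairs A B)))%N.
  by rewrite -sz.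
have pD (j : 'I_(size (subset_imsets A B C))) : p j \in subset_pairs A B.
  by rewrite -mem_enum; exact: mem_nth.
have ev (j : 'I_(size (subset_imsets A B C))) :
    (in_tuple (subset_imsets A B C))`_j ((p i).1 :|: (p i).2 :|: C) = (i == j)%:R.
  rewrite /= (nth_map (finset.set0, finset.set0))// -/(p j) (semi_elementary_coord tABC)//.
  by rewrite /p nth_uniq ?enum_uniq.
(* Evaluation at the set attached to the [i]-th pair isolates the coefficient [k i]. *)
move/(congr1 (fun x : V => x ((p i).1 :|: (p i).2 :|: C))): sum0; rewrite sum_ffunE ffunE.
rewrite (bigD1 i)//= big1 => [|j ji]; rewrite !ffunE ev.
  by rewrite eqxx addr0 /GRing.scale /= mulr1.
by rewrite eq_sym (negbTE ji) /GRing.scale /= mulr0.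
Qed.

Lemma mem_span_subset_imsets A B C X Y : X \subset A -> Y \subset B ->
  imset X Y C \in <<subset_imsets A B C>>%VS.
Proof.
move=> XA YB.
have [->|Y0] := eqVneq Y finset.set0; first by rewrite semi_elementary0 mem0v.
have [->|X0] := eqVneq X finset.set0.
  by rewrite semi_elementaryC semi_elementary0 mem0v.
apply/memv_span/mapP; exists (X, Y) => //.
by rewrite mem_enum; apply/subset_pairsP.
Qed.

(** For G = XYC, the chain rule in each argument gives the second difference u<a,b|G> = u<aX,bY|C> -
    u<aX,Y|C> - u<X,bY|C> + u<X,Y|C>, whose terms with an empty set are 0. *)
Lemma elementary_sub_span A B C :
  elementary_imsets R A B C `<=` [set` <<subset_imsets A B C>>%VS].
Proof.
move=> _ [a [b [G [aA bB CG GU [_ _ ->]]]]] /=.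
rewrite (setI_decomp CG GU); set X := G :&: A; set Y := G :&: B.
have XA : X \subset A by exact: finset.subsetIr.
have YB : Y \subset B by exact: finset.subsetIr.
have aXA : [set a]%SET :|: X \subset A by rewrite finset.subUset finset.sub1set aA.
have bYB : [set b]%SET :|: Y \subset B by rewrite finset.subUset finset.sub1set bB.
have chain (U D E F : {set N}) : imset U D (E :|: F) = imset U (D :|: E) F - imset U E F.
  by rewrite semi_elementary_chain addrK.
rewrite semi_elementaryC chain !(semi_elementaryC [set b]%SET) !chain.
by apply: memvB; apply: memvB; exact: mem_span_subset_imsets.
Qed.

Lemma dim_imset_face A B C : ci_triple A B C ->
  cone_dim (imset_face R A B C) = ((2 ^ #|A| - 1) * (2 ^ #|B| - 1))%N.
Proof.
move=> tABC; have /and5P[_ _ dAB dAC dBC] := tABC.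
rewrite /cone_dim imset_faceE//.
rewrite (linear_span_conic_hull (s := subset_imsets A B C)).
- have /eqP -> := free_subset_imsets tABC.
  by rewrite size_map -cardE card_subset_pairs.
- exact: elementary_sub_span.
- move=> _ /mapP[p + ->]; rewrite mem_enum => /subset_pairsP[_ XA _ YB].
  (* A basis vector u<X,Y|C> decomposes over E<X,Y|C>, which is contained in E<A,B|C>. *)
  have := semi_elementary_conic (disjointWl XA (disjointWr YB dAB))
    (disjointWl XA dAC) (disjointWl YB dBC).
  apply: conic_hullS; apply: elementary_imsetsS => //.
  by rewrite finset.setSU// finset.setUSS.
Qed.

End ImsetFaces.

Theorem corollary5p1 (R : realType) (N : finType) (A B C : {set N}) :
  ci_triple A B C ->
  (forall r : set {ffun {set N} -> R^o},
     extreme_ray (imset_face R A B C) r <->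
     exists2 u, elementary_imsets R A B C u & r = half_line u) /\
  cone_dim (imset_face R A B C) = ((2 ^ #|A| - 1) * (2 ^ #|B| - 1))%N.
Proof.
move=> tABC; split; last exact: dim_imset_face.
by move=> r; exact: imset_face_extreme_ray.
Qed.
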